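(* Consider a semi-deterministic MAC-IC-MAC. Let $(R_{\varTheta_1},R_{\varTheta_2})\in\mathcal{R}_{\mathrm{o}}^{\mathrm{sd}}=\bigcup_{P_{\mathrm{o}}^{\mathrm{sd}}\in\mathcal{P}_{\mathrm{o}}^{\mathrm{sd}}}\mathcal{R}_{\mathrm{o}}^{\mathrm{sd}}(P_{\mathrm{o}}^{\mathrm{sd}})$, say $(R_{\varTheta_1},R_{\varTheta_2})\in\mathcal{R}_{\mathrm{o}}^{\mathrm{sd}}(P_{\mathrm{o}}^{\mathrm{sd}})$. Let $$I_0=I(X_{1.1};S_1|U_1,Q)+I(X_{2.1};S_2|U_2,Q),$$ evaluated with $(Q,X_{\varTheta_1},X_{\varTheta_2})$ distributed according to the marginal of $P_{\mathrm{o}}^{\mathrm{sd}}$ and with $U_i$, given $(Q,X_{\varTheta_1},X_{\varTheta_2})$, distributed as $p_{S_i|X_{i.1}}(\cdot|X_{i.1})$, independently of $(S_1,S_2)$ given the inputs; and for $i\in\{1,2\}$ let $$\tilde R_{\varTheta_i}=\big((R_{i.1}-I_0)^+,(R_{i.2}-I_0)^+,\dots,(R_{i.K_i}-I_0)^+\big).$$ Then $$(\tilde R_{\varTheta_1},\tilde R_{\varTheta_2})\in\mathcal{R}_{\mathrm{in}}^{\mathrm{sd}}:=\bigcup_{P_{\mathrm{in}}^{\mathrm{sd}}\in\mathcal{P}_{\mathrm{in}}^{\mathrm{sd}}}\mathcal{R}_{\mathrm{in}}(P_{\mathrm{in}}^{\mathrm{sd}}).$$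
   Context: **Indices.** $K_1,K_2\ge 1$ are integers. For $i\in\{1,2\}$, $i'$ denotes the other element of $\{1,2\}$, and $\varTheta_i=\{i.1,\dots,i.K_i\}$. $\varUpsilon_i$ always denotes a subset of $\varTheta_i$ containing $i.1$; $\varOmega_i$ always denotes a non-empty subset of $\varTheta_i$; bars denote complements in $\varTheta_i$. For $S\subseteq\varTheta_i$, $X_S=(X_{i.j})_{i.j\in S}$ and $R(S)=\sum_{i.j\in S}R_{i.j}$. $(x)^+=\max\{0,x\}$. **Channel.** A semi-deterministic MAC-IC-MAC has inputs $X_{i.j}$ ($i.j\in\varTheta_1\cup\varTheta_2$) with discrete alphabets; $S_1,S_2$ (discrete alphabets $\mathcal{S}_1,\mathcal{S}_2$) are the outputs of independent discrete memoryless point-to-point channels $p_{S_i|X_{i.1}}(s_i|x_{i.1})$ with inputs $X_{1.1},X_{2.1}$, and the outputs are $Y_i=\phi_i(X_{\varTheta_i},S_{i'})$, where $\phi_i$ is deterministic and for every fixed $x_{\varTheta_i}$ the map $s_{i'}\mapsto\phi_i(x_{\varTheta_i},s_{i'})$ is invertible (one-to-one). **Distributions.** $\mathcal{P}_{\mathrm{o}}^{\mathrm{sd}}$ is the set of joint distributions of $(Q,T_1,X_{\varTheta_1},T_2,X_{\varTheta_2})$, with $T_i\in\mathcal{S}_i$ and $Q$ discrete, that factor as $$p(q)\,p_{S_1|X_{1.1}}(t_1|x_{1.1})\prod_{j=1}^{K_1}p(x_{1.j}|q)\;p_{S_2|X_{2.1}}(t_2|x_{2.1})\prod_{j=1}^{K_2}p(x_{2.j}|q).$$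 $\mathcal{P}_{\mathrm{in}}^{\mathrm{sd}}$ is the set of joint distributions of $(Q,U_1,X_{\varTheta_1},U_2,X_{\varTheta_2})$, with $U_i\in\mathcal{S}_i$, that factor in the same way with $u_i$ in place of $t_i$. In both cases $S_1,S_2,Y_1,Y_2$ are generated from the inputs by the channel, with $(S_1,S_2)$ conditionally independent of $(T_1,T_2)$ (resp. $(U_1,U_2)$) given the inputs. **Generic regions.** For real-valued set functions $\mathcal{A}_{\varUpsilon_i},\mathcal{B}_{\varOmega_i},\mathcal{E}_{\varUpsilon_i},\mathcal{G}_{\varOmega_i}$, let $\mathcal{R}(\mathcal{A},\mathcal{B},\mathcal{E},\mathcal{G})$ be the set of $(R_{\varTheta_1},R_{\varTheta_2})\in\mathbb{R}_+^{K_1+K_2}$ such that for all admissible $\varUpsilon_1,\varOmega_1,\varUpsilon_2,\varOmega_2$: 1. $R(\varOmega_1)\le\mathcal{B}_{\varOmega_1}$ 2. $R(\varUpsilon_1)\le\mathcal{A}_{\varUpsilon_1}+\mathcal{E}_{\varUpsilon_2}$ 3. $R(\varOmega_2)\le\mathcal{B}_{\varOmega_2}$ 4. $R(\varUpsilon_2)\le\mathcal{E}_{\varUpsilon_1}+\mathcal{A}_{\varUpsilon_2}$ 5. $R(\varUpsilon_1)+R(\varOmega_2)\le\mathcal{A}_{\varUpsilon_1}+\mathcal{G}_{\varOmega_2}$ 6. $R(\varOmega_1)+R(\varUpsilon_2)\le\mathcal{G}_{\varOmega_1}+\mathcal{A}_{\varUpsilon_2}$ 7. $R(\varUpsilon_1)+R(\varUpsilon_2)\le\mathcal{E}_{\varUpsilon_1}+\mathcal{E}_{\varUpsilon_2}$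 8. $R(\varUpsilon_1)+R(\varOmega_1)+R(\varUpsilon_2)\le\mathcal{A}_{\varUpsilon_1}+\mathcal{G}_{\varOmega_1}+\mathcal{E}_{\varUpsilon_2}$ 9. $R(\varUpsilon_1)+R(\varUpsilon_2)+R(\varOmega_2)\le\mathcal{E}_{\varUpsilon_1}+\mathcal{A}_{\varUpsilon_2}+\mathcal{G}_{\varOmega_2}$, and let $\mathcal{R}_{\mathrm{c}}(\mathcal{A},\mathcal{B},\mathcal{E},\mathcal{G})$ be the set defined in the same way but with inequalities 2 and 4 omitted. **Outer region.** $\mathcal{R}_{\mathrm{o}}^{\mathrm{sd}}(P_{\mathrm{o}}^{\mathrm{sd}})=\mathcal{R}_{\mathrm{c}}(\overline{\mathsf{A}},\overline{\mathsf{B}},\overline{\mathsf{E}},\overline{\mathsf{G}})$ with, under $P_{\mathrm{o}}^{\mathrm{sd}}$, $$\overline{\mathsf{A}}_{\varUpsilon_i}=H(Y_i|X_{\bar\varUpsilon_i},T_i,X_{i'.1},Q)-H(S_{i'}|X_{i'.1},Q),\quad \overline{\mathsf{B}}_{\varOmega_i}=H(Y_i|X_{\bar\varOmega_i},X_{i'.1},Q)-H(S_{i'}|X_{i'.1},Q),$$ $$\overline{\mathsf{E}}_{\varUpsilon_i}=H(Y_i|X_{\bar\varUpsilon_i},T_i,Q)-H(S_{i'}|X_{i'.1},Q),\quad \overline{\mathsf{G}}_{\varOmega_i}=H(Y_i|X_{\bar\varOmega_i},Q)-H(S_{i'}|X_{i'.1},Q).$$ **Inner region.** $\mathcal{R}_{\mathrm{in}}(P_{\mathrm{in}}^{\mathrm{sd}})=\mathcal{R}(\underline{\mathsf{A}},\underline{\mathsf{B}},\underline{\mathsf{E}},\underline{\mathsf{G}})$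 with, under $P_{\mathrm{in}}^{\mathrm{sd}}$, $$\underline{\mathsf{A}}_{\varUpsilon_i}=H(Y_i|X_{\bar\varUpsilon_i},U_i,U_{i'},Q)-H(S_{i'}|U_{i'},Q),\quad \underline{\mathsf{B}}_{\varOmega_i}=H(Y_i|X_{\bar\varOmega_i},U_{i'},Q)-H(S_{i'}|U_{i'},Q),$$ $$\underline{\mathsf{E}}_{\varUpsilon_i}=H(Y_i|X_{\bar\varUpsilon_i},U_i,Q)-H(S_{i'}|U_{i'},Q),\quad \underline{\mathsf{G}}_{\varOmega_i}=H(Y_i|X_{\bar\varOmega_i},Q)-H(S_{i'}|U_{i'},Q).$$ *)

(* Defs.v *)
From HB Require Import structures.
From mathcomp Require Import all_boot all_order all_algebra.
From mathcomp Require Import all_classical all_reals all_analysis.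
Set Implicit Arguments.
Unset Strict Implicit.
Unset Printing Implicit Defensive.
Import Order.TTheory GRing.Theory Num.Theory.

Local Open Scope classical_set_scope.
Local Open Scope ring_scope.

Section information.
Variables (R : realType) (W : choiceType).
Implicit Types p : W -> R.

Definition is_pmf p : Prop :=
  (forall w, 0 <= p w) /\ \esum_(w in [set: W]) (p w)%:E = 1%E.

Definition prob p (E : set W) : R := fine (\esum_(w in E) (p w)%:E).

Definition log2 (x : R) : R := ln x / ln 2.

(* H(a|b) = E[- log2 p(a|b)]; under a pmf every term is nonnegative, so the
   sum is defined in [0, +oo] even on infinite alphabets. *)
Definition cond_entropy p (A B : Type) (a : W -> A) (b : W -> B) : \bar R :=
  \esum_(w in [set: W])
    (p w * - log2 (prob p [set v | a v = a w /\ b v = b w] /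
                   prob p [set v | b v = b w]))%:E.

(* I(a;b|c) = H(b|c) - H(b|a,c); the entropies of b alone are used because they
   may be finite when those of a are not. *)
Definition cond_mutual_info p (A B C : Type)
    (a : W -> A) (b : W -> B) (c : W -> C) : \bar R :=
  (cond_entropy p b c - cond_entropy p b (fun w => (a w, c w)))%E.

End information.

(* The two receivers are indexed by bool, so that i' is ~~ i. Receiver i has
   K_i = (K i).+1 >= 1 transmitters, and i.1 is ord0. *)
Section regions.
Variables (R : realType) (K : bool -> nat).

Notation users i := 'I_(K i).+1.

Definition rates := forall i : bool, users i -> R.

Definition rate_sum (r : rates) i (A : {set users i}) : \bar R :=
  (\sum_(j in A) r i j)%:E.

Implicit Types A B E G : forall i : bool, {set users i} -> \bar R.

(* The set functions must be real-valued on their domains: with infinite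
   entropies the differences defining them need not make sense. *)
Definition real_valued A B E G : Prop := forall i,
  (forall U : {set users i}, ord0 \in U ->
     A i U \is a fin_num /\ E i U \is a fin_num) /\
  (forall O : {set users i}, O != finset.set0 ->
     B i O \is a fin_num /\ G i O \is a fin_num).

(* Each inequality below stands for itself and its mirror image under
   i <-> ~~ i; U, U' contain the first user, O, O' are nonempty. *)
Definition region_c A B E G : set rates := [set r |
  [/\ real_valued A B E G,
      forall i j, 0 <= r i j &
      forall i (U O : {set users i}) (U' O' : {set users (~~ i)}),
        ord0 \in U -> O != finset.set0 ->
        ord0 \in U' -> O' != finset.set0 ->
      [/\ (rate_sum r O <= B i O)%E,
          (rate_sum r U + rate_sum r O' <= A i U + G (~~ i) O')%E,
          (rate_sum r U + rate_sum r U' <= E i U + E (~~ i) U')%E &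
          (rate_sum r U + rate_sum r O + rate_sum r U'
             <= A i U + G i O + E (~~ i) U')%E]]].

Definition region A B E G : set rates := [set r |
  region_c A B E G r /\
  forall i (U : {set users i}) (U' : {set users (~~ i)}),
    ord0 \in U -> ord0 \in U' ->
    (rate_sum r U <= A i U + E (~~ i) U')%E].

End regions.

Record sd_channel (R : realType) (K : bool -> nat)
    (X : forall i : bool, 'I_(K i).+1 -> countType)
    (S Y : bool -> countType) := SdChannel {
  pS : forall i, X i ord0 -> S i -> R;
  phi : forall i, (forall j, X i j) -> S (~~ i) -> Y i;
  pS_pmf : forall i x, is_pmf (pS (i := i) x);
  phi_inj : forall i x, injective (phi (i := i) x)
}.

Section mac_ic_mac.
Variables (R : realType) (K : bool -> nat).
Variables (X : forall i : bool, 'I_(K i).+1 -> countType).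
Variables (S Y : bool -> countType) (C : sd_channel R X S Y).

Notation users i := 'I_(K i).+1.

Definition inputs : choiceType := forall i (j : users i), X j.
Definition signals : choiceType := forall i, S i.

Section law.
Variable Q : countType.

(* values (q, t, x), where t stands for (T_1, T_2) or (U_1, U_2) *)
Definition source : choiceType := (Q * signals * inputs)%type.

(* source values together with the channel signals (S_1, S_2) *)
Definition outcome : choiceType := (source * signals)%type.

(* The classes of outer and inner distributions have the same definition, up to
   the name of the auxiliary pair: this predicate is used for both. *)
Definition admissible (P : source -> R) : Prop :=
  is_pmf P /\
  exists (pQ : Q -> R) (pX : forall i (j : users i), Q -> X j -> R),
    [/\ is_pmf pQ,
        forall i (j : users i) q, is_pmf (pX i j q) &
        forall q t x, P (q, t, x) =
          pQ q * \prod_(i : bool)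
            (pS C (x i ord0) (t i) * \prod_(j : users i) pX i j q (x i j))].

Definition law (P : source -> R) (w : outcome) : R :=
  P w.1 * \prod_(i : bool) pS C (w.1.2 i ord0) (w.2 i).

Definition rvQ (w : outcome) : Q := w.1.1.1.
Definition rvT i (w : outcome) : S i := w.1.1.2 i.
Definition rvX1 i (w : outcome) : X ord0 := w.1.2 i ord0.
Definition rvXs i (A : {set users i}) (w : outcome) :
  forall j : {j : users i | j \in A}, X (val j) := fun j => w.1.2 i (val j).
Definition rvS i (w : outcome) : S i := w.2 i.
Definition rvY i (w : outcome) : Y i := phi C (w.1.2 i) (w.2 (~~ i)).

Variable P : source -> R.

Local Notation H a b := (cond_entropy (law P) a b).
Local Notation I a b c := (cond_mutual_info (law P) a b c).

Definition outer_A i (U : {set users i}) : \bar R :=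
  (H (@rvY i) (fun w => (@rvXs i (~: U) w, rvT i w, rvX1 (~~ i) w, rvQ w))
   - H (@rvS (~~ i)) (fun w => (rvX1 (~~ i) w, rvQ w)))%E.

Definition outer_B i (O : {set users i}) : \bar R :=
  (H (@rvY i) (fun w => (@rvXs i (~: O) w, rvX1 (~~ i) w, rvQ w))
   - H (@rvS (~~ i)) (fun w => (rvX1 (~~ i) w, rvQ w)))%E.

Definition outer_E i (U : {set users i}) : \bar R :=
  (H (@rvY i) (fun w => (@rvXs i (~: U) w, rvT i w, rvQ w))
   - H (@rvS (~~ i)) (fun w => (rvX1 (~~ i) w, rvQ w)))%E.

Definition outer_G i (O : {set users i}) : \bar R :=
  (H (@rvY i) (fun w => (@rvXs i (~: O) w, rvQ w))
   - H (@rvS (~~ i)) (fun w => (rvX1 (~~ i) w, rvQ w)))%E.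

Definition outer_region_at : set (rates R K) :=
  region_c outer_A outer_B outer_E outer_G.

Definition inner_A i (U : {set users i}) : \bar R :=
  (H (@rvY i) (fun w => (@rvXs i (~: U) w, rvT i w, rvT (~~ i) w, rvQ w))
   - H (@rvS (~~ i)) (fun w => (rvT (~~ i) w, rvQ w)))%E.

Definition inner_B i (O : {set users i}) : \bar R :=
  (H (@rvY i) (fun w => (@rvXs i (~: O) w, rvT (~~ i) w, rvQ w))
   - H (@rvS (~~ i)) (fun w => (rvT (~~ i) w, rvQ w)))%E.

Definition inner_E i (U : {set users i}) : \bar R :=
  (H (@rvY i) (fun w => (@rvXs i (~: U) w, rvT i w, rvQ w))
   - H (@rvS (~~ i)) (fun w => (rvT (~~ i) w, rvQ w)))%E.

Definition inner_G i (O : {set users i}) : \bar R :=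
  (H (@rvY i) (fun w => (@rvXs i (~: O) w, rvQ w))
   - H (@rvS (~~ i)) (fun w => (rvT (~~ i) w, rvQ w)))%E.

Definition inner_region_at : set (rates R K) :=
  region inner_A inner_B inner_E inner_G.

Definition sum_cond_info : \bar R :=
  (\sum_(i : bool) I (@rvX1 i) (@rvS i) (fun w => (rvT i w, rvQ w)))%E.

(* Keeps the marginal of (Q, X) under P and draws U_i afresh from p_{S_i|X_i.1}. *)
Definition resampled : source -> R := fun w =>
  fine (\esum_(t in [set: signals]) (P (w.1.1, t, w.2))%:E) *
  \prod_(i : bool) pS C (w.2 i ord0) (w.1.2 i).

End law.

(* The time-sharing alphabet is not fixed in advance. *)
Definition inner_region : set (rates R K) := [set r |
  exists (Q : countType) (P : source Q -> R),
    admissible P /\ inner_region_at P r].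

(* I_0, in bits *)
Definition gap (Q : countType) (P : source Q -> R) : R :=
  fine (sum_cond_info (resampled P)).

End mac_ic_mac.

(* Main.v *)
(* Under an admissible [P] the signal T_i is already drawn from p_{S_i|X_i.1},
   independently of S_i, so [P] equals its own resampling and serves as the
   inner distribution. Put I_i = I(X_i.1; S_i | T_i, Q), so that I_0 = I_1 + I_2.
   Dropping conditioning on X_i'.1 and using that T_i' depends on the rest only
   through X_i'.1, each inner set function of receiver i is at least its outer
   counterpart minus I_i'.  Inequality 2, absent from the outer region, follows
   from the bound on B: with S_i and T_i identically distributed,
     B_U - A_U = I(Y_i; T_i | X_~U, T_i', Q) <= H(S_i | Q) - H(S_i | X_i.1, Q),
     E_U' >= H(S_i | Q) - H(S_i | T_i, Q),
   whence B_U <= A_U + E_U' + I_i.  Finally, lowering every rate by I_0 and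
   truncating at 0 lowers a rate sum by at least I_0 unless it becomes 0.  This
   pays for the loss in every inequality, except in 8 when a single one of the
   three sums stays positive: then 8 follows from inequality 2, 1 or 6
   and the nonnegativity of the inner set functions. *)
Require Import Defs.
From HB Require Import structures.
From mathcomp Require Import all_boot all_order all_algebra.
From mathcomp Require Import all_classical all_reals all_analysis.
From mathcomp Require Import ring lra.
Import Order.TTheory GRing.Theory Num.Theory.

Local Open Scope classical_set_scope.
Local Open Scope ring_scope.

(** * Sums of nonnegative extended reals over arbitrary index sets *)

Section esum_complements.
Set Implicit Arguments.
Unset Strict Implicit.
Variable R : realType.

Lemma ge0_esumZl (T : choiceType) (I : set T) (c : R) (a : T -> \bar R) :
  0 <= c -> (forall i, 0 <= a i)%E ->
  (\esum_(i in I) (c%:E * a i) = c%:E * \esum_(i in I) a i)%E.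
Proof.
move=> c0 a0; rewrite /esum -ereal_supZl//; last first.
  apply/set0P; exists (\sum_(x \in set0) a x)%E; exists set0 => //.
  exact: fsets_set0.
congr ereal_sup; apply/seteqP; split=> [_ [A AI <-]|_ [_ [A AI <-] <-]].
  by exists (\sum_(x \in A) a x)%E; [exists A|rewrite ge0_mule_fsumr].
by exists A => //; rewrite ge0_mule_fsumr.
Qed.

Lemma esum_exchange (T U : choiceType) (I : set T) (J : T -> set U)
    (I' : set U) (J' : U -> set T) (a : T -> U -> \bar R) :
  (forall i j, 0 <= a i j)%E ->
  (forall i j, I i /\ J i j <-> I' j /\ J' j i) ->
  (\esum_(i in I) \esum_(j in J i) a i j =
   \esum_(j in I') \esum_(i in J' j) a i j)%E.
Proof.
move=> a0 IJ; rewrite !esum_esum//.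
rewrite (@reindex_esum _ _ _ (I' `*`` J') (I `*`` J) (fun k => (k.2, k.1)))//.
split=> [[j i] /= /IJ//|[j i] [j' i'] _ _ /= [-> ->]//|[i j] /= /IJ ij].
by exists (j, i).
Qed.

Lemma esum_mul (T U : choiceType) (I : set T) (J : set U)
    (a : T -> R) (b : U -> R) :
  (forall i, 0 <= a i) -> (forall j, 0 <= b j) ->
  (\esum_(j in J) (b j)%:E \is a fin_num)%E ->
  (\esum_(k in I `*` J) (a k.1 * b k.2)%:E =
   (\esum_(i in I) (a i)%:E) * \esum_(j in J) (b j)%:E)%E.
Proof.
move=> a0 b0 bfin.
rewrite -(@esum_esum _ _ _ I (fun=> J) (fun i j => (a i * b j)%:E)); last first.
  by move=> *; rewrite lee_fin mulr_ge0.
have E i : \esum_(j in J) (a i * b j)%:E =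
    ((a i)%:E * \esum_(j in J) (b j)%:E)%E.
  by rewrite -ge0_esumZl// => j; rewrite lee_fin.
under eq_esum => i _ do rewrite E.
rewrite -(fineK bfin) muleC -ge0_esumZl//.
- by apply: eq_esum => i _; rewrite muleC.
- by rewrite fine_ge0// esum_ge0// => j _; rewrite lee_fin.
Qed.

Lemma le_esum_subset (T : choiceType) (I J : set T) (a : T -> \bar R) :
  (forall i, 0 <= a i)%E -> I `<=` J ->
  (\esum_(i in I) a i <= \esum_(i in J) a i)%E.
Proof.
move=> a0 IJ; rewrite esum_mkcond [leRHS]esum_mkcond le_esum// => i _.
have [iI|_] := boolP (i \in I); last by case: ifP.
by rewrite (_ : i \in J)//; apply/mem_set/IJ/set_mem.
Qed.

End esum_complements.

(** * Conditional entropy *)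

Section information.
Set Implicit Arguments.
Unset Strict Implicit.
Variables (R : realType) (W : choiceType) (p : W -> R).
Hypothesis p_pmf : is_pmf p.

Let p_ge0 w : 0 <= p w. Proof. exact: p_pmf.1. Qed.
Let pE_ge0 w : (0 <= (p w)%:E)%E. Proof. by rewrite lee_fin. Qed.

Lemma esum_pmf_fin_num (E : set W) : \esum_(w in E) (p w)%:E \is a fin_num.
Proof.
rewrite ge0_fin_numE; last exact: esum_ge0.
by rewrite (le_lt_trans (le_esum_subset pE_ge0 (@subsetT _ E)))// p_pmf.2 ltry.
Qed.

Lemma EFin_prob (E : set W) : (prob p E)%:E = \esum_(w in E) (p w)%:E.
Proof. by rewrite fineK// esum_pmf_fin_num. Qed.

Lemma prob_ge0 (E : set W) : 0 <= prob p E.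
Proof. by rewrite -lee_fin EFin_prob esum_ge0. Qed.

Lemma le_prob (E F : set W) : E `<=` F -> prob p E <= prob p F.
Proof. by move=> EF; rewrite -lee_fin !EFin_prob le_esum_subset. Qed.

Lemma prob_gt0 (E : set W) w : E w -> 0 < p w -> 0 < prob p E.
Proof.
move=> Ew pw; rewrite -lte_fin EFin_prob.
apply: (@lt_le_trans _ _ (\esum_(v in [set w]) (p v)%:E)%E).
  by rewrite esum_set1.
by apply: le_esum_subset => // v ->.
Qed.

Lemma prob_mul (E F : set W) :
  (prob p E * prob p F)%:E = \esum_(k in E `*` F) (p k.1 * p k.2)%:E.
Proof. by rewrite esum_mul ?esum_pmf_fin_num// EFinM !EFin_prob. Qed.

Lemma pmf_gt0_or_eq0 w : 0 < p w \/ p w = 0.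
Proof. by have := p_ge0 w; rewrite le_eqVlt => /predU1P[<-|]; [right|left]. Qed.

Section cond_prob.
Variables (A B : Type) (a : W -> A) (b : W -> B).

Definition cond_prob w : R :=
  prob p [set v | a v = a w /\ b v = b w] / prob p [set v | b v = b w].

Lemma cond_prob_gt0 w : 0 < p w -> 0 < cond_prob w.
Proof. by move=> pw; rewrite divr_gt0// (@prob_gt0 _ w). Qed.

Lemma cond_prob_ge0 w : 0 <= cond_prob w.
Proof. by rewrite divr_ge0 ?prob_ge0. Qed.

Lemma cond_prob_le1 w : 0 < p w -> cond_prob w <= 1.
Proof.
move=> pw; rewrite ler_pdivrMr ?mul1r; last by rewrite (@prob_gt0 _ w).
by apply: le_prob => v [].
Qed.

Lemma cond_entropy_term_ge0 w : 0 <= p w * - log2 (cond_prob w).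
Proof.
have [pw|->] := pmf_gt0_or_eq0 w; last by rewrite mul0r.
rewrite mulr_ge0// oppr_ge0 /log2 pmulr_lle0 ?ln_le0 ?cond_prob_le1//.
by rewrite invr_gt0 ln_gt0// ltr1n.
Qed.

Lemma cond_entropy_ge0 : (0 <= cond_entropy p a b)%E.
Proof. by apply: esum_ge0 => w _; rewrite lee_fin cond_entropy_term_ge0. Qed.

End cond_prob.

Section conditioning.
Variables (A B C : Type) (a : W -> A) (b : W -> B) (c : W -> C).
Hypothesis bc : forall v w, b v = b w -> c v = c w.

Let pab w := prob p [set v | a v = a w /\ b v = b w].
Let pac w := prob p [set v | a v = a w /\ c v = c w].
Let pb w := prob p [set v | b v = b w].
Let pc w := prob p [set v | c v = c w].

(** Expanding [pb w] and [pac w] as sums over [v] and [u] makes the left side a triple sum. Summing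
    over [w] first leaves a factor at most 1, summing over [u] then cancels [pc v], and the masses
    [p v] add up to 1. *)
Lemma esum_likelihood_ratio_le1 :
  (\esum_(w in [set: W]) (p w * (cond_prob a c w / cond_prob a b w))%:E <= 1)%E.
Proof.
have E1 w : (p w * (cond_prob a c w / cond_prob a b w))%:E =
    \esum_(v in [set v | b v = b w]) \esum_(u in [set u | a u = a w /\ c u = c w])
      (p v / pc v * p u * (p w / pab w))%:E.
  have Eu v : b v = b w ->
      \esum_(u in [set u | a u = a w /\ c u = c w])
        (p v / pc v * p u * (p w / pab w))%:E =
      ((p w / pab w * pac w / pc w)%:E * (p v)%:E)%E.
    move=> bv; rewrite (_ : pc v = pc w); last by rewrite /pc (bc bv).
    rewrite -EFinM (_ : _ * p v = p w / pab w * p v / pc w * pac w); last by ring.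
    rewrite EFinM EFin_prob -ge0_esumZl ?mulr_ge0 ?invr_ge0 ?prob_ge0//.
    by apply: eq_esum => u _; rewrite -EFinM; congr (_%:E); ring.
  rewrite (eq_esum Eu) ge0_esumZl ?mulr_ge0 ?invr_ge0 ?prob_ge0//.
  rewrite -EFin_prob -EFinM; congr (_%:E).
  by rewrite /cond_prob -/(pac w) -/(pc w) -/(pab w) -/(pb w) invf_div; ring.
under eq_esum => w _ do rewrite E1.
have t_ge0 v u w : (0 <= (p v / pc v * p u * (p w / pab w))%:E)%E.
  by rewrite lee_fin !mulr_ge0// ?invr_ge0 ?prob_ge0.
rewrite (@esum_exchange _ _ _ _ _ [set: W] (fun v => [set w | b v = b w])) //;
  last by move=> w v; apply: esum_ge0.
apply: (@le_trans _ _ (\esum_(v in [set: W]) (p v)%:E)%E); last by rewrite p_pmf.2.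
apply: le_esum => v _.
rewrite (@esum_exchange _ _ _ _ _ [set u | c u = c v]
  (fun u => [set w | a w = a u /\ b w = b v])) //; last first.
  move=> w u; split=> /= [[bw [-> cu]]|[-> [-> bw]]]; last by rewrite bw (bc bw).
  by rewrite cu (bc bw).
apply: (@le_trans _ _ (\esum_(u in [set u | c u = c v])
    ((p v / pc v)%:E * (p u)%:E))%E).
  apply: le_esum => u _; rewrite (eq_esum (b := fun w => 
      (p v / pc v * p u / prob p [set w | a w = a u /\ b w = b v])%:E *
      (p w)%:E))%E; last first.
    move=> w [aw bw]; rewrite -EFinM /pab aw bw; congr (_%:E).
    by rewrite mulrA mulrAC.
  rewrite ge0_esumZl ?mulr_ge0 ?invr_ge0 ?prob_ge0// -EFin_prob -!EFinM lee_fin.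
  rewrite mulrAC -mulrA ler_piMr ?mulr_ge0 ?invr_ge0 ?prob_ge0//.
  (* On a null event the inverse is 0 by convention, so the factor is 0 instead of 1. *)
  have [->|] := eqVneq (prob p [set w | a w = a u /\ b w = b v]) 0.
    by rewrite mul0r.
  by move=> /divff ->.
rewrite ge0_esumZl ?mulr_ge0 ?invr_ge0 ?prob_ge0// -EFin_prob -EFinM -/(pc v).
have [pv|->] := pmf_gt0_or_eq0 v; last by rewrite !mul0r.
by rewrite divfK// gt_eqF// (@prob_gt0 _ v).
Qed.

Theorem cond_entropy_le : (cond_entropy p a b <= cond_entropy p a c)%E.
Proof.
(* Gibbs' inequality: ln x <= x - 1 at the ratio of the conditional
   probabilities. The constant 1 / ln 2 is moved so that all terms summed are
   nonnegative, hence no entropy has to be finite. *)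
have ln2_gt0 : 0 < (ln 2)^-1 :> R by rewrite invr_gt0 ln_gt0// ltr1n.
rewrite -(@leeD2rE _ (ln 2)^-1%:E)//.
apply: (@le_trans _ _ (cond_entropy p a c +
  \esum_(w in [set: W])
    ((ln 2)^-1 * (p w * (cond_prob a c w / cond_prob a b w)))%:E)%E); last first.
  rewrite leeD2l//; under eq_esum do rewrite EFinM.
  rewrite ge0_esumZl ?(ltW ln2_gt0)//; last first.
    by move=> w; rewrite lee_fin mulr_ge0// divr_ge0// cond_prob_ge0.
  by rewrite -[leRHS]mule1 lee_wpmul2l ?esum_likelihood_ratio_le1// lee_fin ltW.
rewrite -[in leLHS](mule1 (ln 2)^-1%:E) -p_pmf.2 -ge0_esumZl ?(ltW ln2_gt0)//.
rewrite -!esumD; first last.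
- by move=> w _; rewrite mule_ge0 ?lee_fin ?(ltW ln2_gt0).
- by move=> w _; rewrite lee_fin cond_entropy_term_ge0.
- move=> w _; rewrite lee_fin mulr_ge0 ?(ltW ln2_gt0)// mulr_ge0// divr_ge0//;
    exact: cond_prob_ge0.
- by move=> w _; rewrite lee_fin cond_entropy_term_ge0.
apply: le_esum => w _; rewrite -EFinM -!EFinD lee_fin.
have [pw|->] := pmf_gt0_or_eq0 w; last by rewrite !(mul0r, mulr0).
have b0 := cond_prob_gt0 a b pw; have c0 := cond_prob_gt0 a c pw.
rewrite -/(cond_prob a b w) -/(cond_prob a c w) /log2.
rewrite [leLHS](_ : _ = (ln 2)^-1 * p w * (1 - ln (cond_prob a b w))); last by ring.
rewrite [leRHS](_ : _ = (ln 2)^-1 * p w *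
  (cond_prob a c w / cond_prob a b w - ln (cond_prob a c w))); last by ring.
rewrite ler_pM2l ?mulr_gt0//.
have /le_ln1Dx : -1 < cond_prob a c w / cond_prob a b w - 1.
  by rewrite ltrBrDr addNr divr_gt0.
by rewrite [1 + _]addrC subrK lnM ?posrE ?invr_gt0// lnV ?posrE//; lra.
Qed.


End conditioning.

Lemma eq_cond_entropy (A A' B : Type) (a : W -> A) (a' : W -> A') (b : W -> B) :
  (forall v w, b v = b w -> a v = a w <-> a' v = a' w) ->
  cond_entropy p a b = cond_entropy p a' b.
Proof.
move=> aa'; apply: eq_esum => w _.
suff -> : [set v | a v = a w /\ b v = b w] = [set v | a' v = a' w /\ b v = b w] by [].
by apply/seteqP; split=> v /= [av bv]; split=> //; apply/(aa' v w).
Qed.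

Lemma eq_cond_entropy_cond (A B C : Type) (a : W -> A) (b : W -> B) (c : W -> C) :
  (forall v w, b v = b w <-> c v = c w) ->
  cond_entropy p a b = cond_entropy p a c.
Proof.
by move=> bc; apply/eqP; rewrite eq_le !cond_entropy_le// => v w /bc.
Qed.

(* [mix v v'] carries the value of [a] from [v] and that of [b] from [v'].
   Exchanging these parts between two independent samples that agree on [c]
   preserves the product weight, whence
   p(a, b) p(c) = p(a, c) p(b). *)
Lemma cond_entropy_markov (A B C : Type) (a : W -> A) (b : W -> B) (c : W -> C)
    (mix : W -> W -> W) :
  (forall v w, b v = b w -> c v = c w) ->
  (forall v v', c v = c v' ->
    [/\ p (mix v v') * p (mix v' v) = p v * p v', a (mix v v') = a v,
        b (mix v v') = b v' & mix (mix v v') (mix v' v) = v]) ->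
  cond_entropy p a b = cond_entropy p a c.
Proof.
move=> bc mixP; apply: eq_esum => w _; have [pw|->] := pmf_gt0_or_eq0 w; last first.
  by rewrite !mul0r.
congr (_ * - log2 _)%:E.
have b0 : prob p [set v | b v = b w] != 0 by rewrite gt_eqF// (@prob_gt0 _ w).
have c0 : prob p [set v | c v = c w] != 0 by rewrite gt_eqF// (@prob_gt0 _ w).
apply/eqP; rewrite eqr_div//; apply/eqP/EFin_inj; rewrite !prob_mul.
have mixc v v' : c v = c v' -> c (mix v v') = c v' /\ c (mix v' v) = c v.
  move=> cv; have [_ _ /bc ? _] := mixP _ _ cv.
  by have [_ _ /bc ? _] := mixP _ _ (esym cv).
(* On pairs agreeing on [c] the exchange is an involution; it moves the constraint on [b] from the
   first sample to the second. *)
rewrite (@reindex_esum _ _ _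
  ([set v | a v = a w /\ b v = b w] `*` [set v | c v = c w])
  ([set v | a v = a w /\ c v = c w] `*` [set v | b v = b w])
  (fun k => (mix k.1 k.2, mix k.2 k.1))).
  apply: eq_esum => -[v v'] /= [[_ /bc cv] cv'].
  by have [-> _ _ _] := mixP v v' (etrans cv (esym cv')).
split=> [[v v'] /= [[av bv] cv']|[u u'] [v v']|[u u'] /= [[au cu] bu']].
- have cv := etrans (bc _ _ bv) (esym cv').
  have [_ -> _ _] := mixP _ _ cv; have [_ _ -> _] := mixP _ _ (esym cv).
  by have [-> _] := mixc _ _ cv.
- move=> /set_mem /= [[_ /bc cu] cu'] /set_mem /= [[_ /bc cv] cv'] [muv mvu].
  have cuu' := etrans cu (esym cu'); have cvv' := etrans cv (esym cv').
  have [_ _ _] := mixP _ _ cuu'; have [_ _ _] := mixP _ _ (esym cuu').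
  have [_ _ _ mv] := mixP _ _ cvv'; have [_ _ _ mv'] := mixP _ _ (esym cvv').
  by rewrite muv mvu mv mv' => <- <-.
- have cuu' := etrans cu (esym (bc _ _ bu')).
  exists (mix u u', mix u' u) => /=.
    by have [_ -> -> _] := mixP _ _ cuu'; have [_ ->] := mixc _ _ cuu'.
  have [_ _ _ ->] := mixP _ _ cuu'.
  by have [_ _ _ ->] := mixP _ _ (esym cuu').
Qed.

(** Both sides are chain-rule expansions of H(a, b | c). They agree outcome by outcome, so infinite
    entropies are allowed. *)
Lemma cond_entropy_symmetry (A B C : Type) (a : W -> A) (b : W -> B) (c : W -> C) :
  (cond_entropy p a c + cond_entropy p b (fun w => (a w, c w)) =
   cond_entropy p b c + cond_entropy p a (fun w => (b w, c w)))%E.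
Proof.
rewrite -!esumD; try by move=> w _; rewrite lee_fin cond_entropy_term_ge0.
apply: eq_esum => w _; rewrite -!EFinD; congr (_%:E).
have [pw|->] := pmf_gt0_or_eq0 w; last by rewrite !mul0r.
have ac0 : 0 < prob p [set v | a v = a w /\ c v = c w] by rewrite (@prob_gt0 _ w).
have bc0 : 0 < prob p [set v | b v = b w /\ c v = c w] by rewrite (@prob_gt0 _ w).
have c0 : 0 < prob p [set v | c v = c w] by rewrite (@prob_gt0 _ w).
have abc0 : 0 < prob p [set v | [/\ a v = a w, b v = b w & c v = c w]].
  by rewrite (@prob_gt0 _ w).
have -> : [set v | (a v, c v) = (a w, c w)] = [set v | a v = a w /\ c v = c w].
  by apply/seteqP; split=> v /= [-> ->].
have -> : [set v | (b v, c v) = (b w, c w)] = [set v | b v = b w /\ c v = c w].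
  by apply/seteqP; split=> v /= [-> ->].
have -> : [set v | b v = b w /\ (a v, c v) = (a w, c w)] =
    [set v | [/\ a v = a w, b v = b w & c v = c w]].
  by apply/seteqP; split=> v /= [-> [-> ->]].
have -> : [set v | a v = a w /\ (b v, c v) = (b w, c w)] =
    [set v | [/\ a v = a w, b v = b w & c v = c w]].
  by apply/seteqP; split=> v /= [-> [-> ->]].
rewrite /log2 !ln_div ?posrE//; ring.
Qed.

(** Applied below to the swap of the pairs T and S, which preserves the law. *)
Lemma cond_entropy_reindex (f : W -> W) (A B : Type) (a : W -> A) (b : W -> B) :
  involutive f -> (forall w, p (f w) = p w) ->
  cond_entropy p (a \o f) (b \o f) = cond_entropy p a b.
Proof.
move=> fK pf.
have bij_f (D : set W) : set_bij (f @^-1` D) D f.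
  split=> [//|v w _ _ /(can_inj fK)//|w Dw].
  by exists (f w); rewrite /= fK.
have probf (D : set W) : prob p (f @^-1` D) = prob p D.
  rewrite /prob (reindex_esum _ _ _ _ (bij_f D)).
  by congr fine; apply: eq_esum => w _; rewrite pf.
rewrite {2}/cond_entropy (reindex_esum _ _ _ _ (bij_f setT)); apply: eq_esum => w _.
rewrite pf -(probf [set v | a v = a (f w) /\ b v = b (f w)]).
by rewrite -(probf [set v | b v = b (f w)]).
Qed.

End information.

(** * Rate regions up to a gap *)

(** If some [r j] with [j] in [D] exceeds [d], that term alone pays the full [d] and the others do
    not increase; otherwise every term is truncated to 0. *)
Lemma sum_max_shift (R : realType) (I : finType) (D : {set I}) (r : I -> R)
    (d : R) :
  0 <= d -> (forall j, 0 <= r j) ->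
  \sum_(j in D) Num.max 0 (r j - d) = 0 \/
  \sum_(j in D) Num.max 0 (r j - d) <= \sum_(j in D) r j - d.
Proof.
move=> d0 r0.
have [/existsP[j /andP[jD dj]]|] := boolP [exists j, (j \in D) && (d < r j)].
  right; rewrite (bigD1 j)//= [in leRHS](bigD1 j)//= addrAC.
  rewrite max_r ?subr_ge0 ?(ltW dj)// lerD2l ler_sum// => k _.
  by rewrite ge_max r0 gerBl.
rewrite negb_exists => /forallP Dd; left; apply: big1 => j jD.
by move: (Dd j); rewrite jD /= -leNgt => rd; rewrite max_l// subr_le0.
Qed.

Section region_shift.
Set Implicit Arguments.
Unset Strict Implicit.
Variables (R : realType) (K : bool -> nat).
Notation users i := 'I_(K i).+1.
Variables (A B E G A' B' E' G' : forall i, {set users i} -> \bar R).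
Variables (g : bool -> R) (r : rates R K).
Hypothesis r_outer : region_c A B E G r.
Hypothesis fin_inner : real_valued A' B' E' G'.
Hypothesis g_ge0 : forall i, 0 <= g i.
Hypothesis AA' : forall i (U : {set users i}), ord0 \in U ->
  (A U <= A' U + (g (~~ i))%:E)%E.
Hypothesis EE' : forall i (U : {set users i}), ord0 \in U ->
  (E U <= E' U + (g (~~ i))%:E)%E.
Hypothesis BB' : forall i (O : {set users i}), O != finset.set0 ->
  (B O <= B' O + (g (~~ i))%:E)%E.
Hypothesis GG' : forall i (O : {set users i}), O != finset.set0 ->
  (G O <= G' O + (g (~~ i))%:E)%E.
Hypothesis A'E' : forall i (U : {set users i}), ord0 \in U ->
  (0 <= A' U <= E' U)%E.
Hypothesis B'G' : forall i (O : {set users i}), O != finset.set0 ->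
  (0 <= B' O <= G' O)%E.
Hypothesis B'A'E' : forall i (U : {set users i}) (U' : {set users (~~ i)}),
  ord0 \in U -> ord0 \in U' -> (B' U <= A' U + E' U' + (g i)%:E)%E.

Let d := g true + g false.
Let r' : rates R K := fun i j => Num.max 0 (r j - d).

Let dE i : d = g i + g (~~ i). Proof. by case: i; rewrite /d // addrC. Qed.

Let r_ge0 i (j : users i) : 0 <= r j. Proof. by case: r_outer => _ /(_ i j). Qed.

Let rP i (D : {set users i}) :
  [/\ rate_sum r D = (\sum_(j in D) r j)%:E,
      rate_sum r' D = (\sum_(j in D) r' j)%:E,
      0 <= \sum_(j in D) r j &
      \sum_(j in D) r' j = 0 \/ \sum_(j in D) r' j <= \sum_(j in D) r j - d].
Proof.
split=> //; first by apply: sumr_ge0.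
by apply: sum_max_shift => //; rewrite addr_ge0.
Qed.

Lemma region_shift : region A' B' E' G' r'.
Proof.
have [fin_outer _ r_ineq] := r_outer.
(* Inequality 6 is inequality 5 at [~~ i]. As [~~ ~~ i] reduces to [i] only for a concrete boolean,
   [i] is split; the singleton of the first user serves as an admissible set. *)
have mirror i (O : {set users i}) (U' : {set users (~~ i)}) :
    O != finset.set0 -> ord0 \in U' ->
    (rate_sum r O + rate_sum r U' <= G O + A U')%E.
  move=> O0 U0'; have U0'' : U' != finset.set0 by apply/set0Pn; exists ord0.
  have ord0_1 k : ord0 \in [set ord0 : users k]%SET by rewrite finset.inE.
  rewrite addeC [leRHS]addeC; case: i O U' O0 U0' U0'' => O U' O0 U0' U0''.
  - by have [_ + _ _] := r_ineq false U' U' _ O U0' U0'' (ord0_1 _) O0.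
  - by have [_ + _ _] := r_ineq true U' U' _ O U0' U0'' (ord0_1 _) O0.
(* Inequality 2: passing from [B] to [B'] costs [g (~~ i)] and from [B'] to [A' + E'] costs [g i],
   together exactly [d]. If the truncated sum is 0, nonnegativity suffices. *)
have single i (U : {set users i}) (U' : {set users (~~ i)}) :
    ord0 \in U -> ord0 \in U' -> (rate_sum r' U <= A' U + E' U')%E.
  move=> U0 U0'; have U0'' : U != finset.set0 by apply/set0Pn; exists ord0.
  have U0''' : U' != finset.set0 by apply/set0Pn; exists ord0.
  have [+ _ _ _] := r_ineq i U U U' U' U0 U0'' U0' U0'''.
  have /andP[] := A'E' U0; have /andP[] := A'E' U0'.
  have := B'A'E' U0 U0'; have := BB' U0''.
  have [/(_ _ U0)[/fineK <- /fineK <-] /(_ _ U0'')[/fineK <- _]] := fin_inner i.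
  have [/(_ _ U0')[/fineK <- /fineK <-] _] := fin_inner (~~ i).
  have [_ /(_ _ U0'')[/fineK <- _]] := fin_outer i.
  have [-> -> rU r'U] := rP U; have := dE i.
  rewrite -!EFinD !lee_fin; lra.
split=> //; split=> //.
  by move=> i j; rewrite le_max lexx.
move=> i U O U' O' U0 O0 U0' O0'.
have [+ + + +] := r_ineq i U O U' O' U0 O0 U0' O0'.
have := mirror i O U' O0 U0'.
have := single i U U' U0 U0'.
have /andP[] := A'E' U0; have /andP[] := A'E' U0'.
have /andP[] := B'G' O0; have /andP[] := B'G' O0'.
have := AA' U0; have := EE' U0; have := AA' U0'; have := EE' U0'.
have := BB' O0; have := GG' O0; have := GG' O0'.
rewrite !negbK.
have [/(_ _ U0)[/fineK <- /fineK <-] /(_ _ O0)[/fineK <- /fineK <-]] := fin_inner i.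
have [/(_ _ U0')[/fineK <- /fineK <-] /(_ _ O0')[/fineK <- /fineK <-]] :=
  fin_inner (~~ i).
have [/(_ _ U0)[/fineK <- /fineK <-] /(_ _ O0)[/fineK <- /fineK <-]] := fin_outer i.
have [/(_ _ U0')[/fineK <- /fineK <-] /(_ _ O0')[_ /fineK <-]] :=
  fin_outer (~~ i).
have [-> -> rU r'U] := rP U; have [-> -> rO r'O] := rP O.
have [-> -> rU' r'U'] := rP U'; have [-> -> rO' r'O'] := rP O'.
have := dE i; have := g_ge0 i; have := g_ge0 (~~ i).
rewrite -!EFinD !lee_fin => *.
(* In inequalities 5 and 7 the right side loses exactly [d], which one positive sum pays. In 8 it
   loses [2 g (~~ i) + g i <= 2 d], which takes two positive sums. If only one is positive, [single]
   settles [U], the bound on [B] with [B' <= G'] settles [O], and [mirror] with [A' <= E'] settles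
   [U']. *)
by split; rewrite ?lee_fin; lra.
Qed.

End region_shift.

(** * Entropies under an admissible law *)

Section law.
Set Implicit Arguments.
Unset Strict Implicit.
Variables (R : realType) (K : bool -> nat).
Variables (X : forall i : bool, 'I_(K i).+1 -> countType).
Variables (S Y : bool -> countType) (C : sd_channel R X S Y).
Variables (Q : countType) (P : source X S Q -> R).
Hypothesis P_adm : admissible C P.
Notation users i := 'I_(K i).+1.
Notation outcome := (outcome X S Q).

Lemma esum_signals (f : forall i, S i -> R) : (forall i, is_pmf (f i)) ->
  \esum_(s in [set: signals S]) (\prod_(i : bool) f i (s i))%:E = 1%E.
Proof.
move=> f_pmf.
pose e (u : S true * S false) : signals S :=
  fun i => if i is true then u.1 else u.2.
rewrite (@reindex_esum _ _ _ ([set: S true] `*` [set: S false]) _ e); last first.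
  split=> // [[s0 s1] [t0 t1] _ _ st|s _].
    by have := congr1 (@^~ true) st; have := congr1 (@^~ false) st => /= -> ->.
  exists (s true, s false) => //; apply: functional_extensionality_dep.
  by case.
under eq_esum do rewrite big_bool.
rewrite (@esum_mul _ _ _ _ _ (f true) (f false)).
- by rewrite !(f_pmf _).2 mule1.
- exact: (f_pmf _).1.
- exact: (f_pmf _).1.
- by rewrite (f_pmf _).2.
Qed.

Lemma law_pmf : is_pmf (law C P).
Proof.
have P_ge0 := P_adm.1.1.
have pS_ge0 i x s : 0 <= pS C (i := i) x s by have [] := pS_pmf C x.
split=> [w|]; first by rewrite mulr_ge0// prodr_ge0.
rewrite (_ : [set: outcome] = [set: source X S Q] `*`` (fun=> [set: signals S]));
  last by apply/seteqP.
rewrite -(@esum_esum _ _ _ _ _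
  (fun w s => (P w * \prod_(i : bool) pS C (w.2 i ord0) (s i))%:E)); last first.
  by move=> *; rewrite lee_fin mulr_ge0// prodr_ge0.
rewrite -P_adm.1.2; apply: eq_esum => w _; under eq_esum do rewrite EFinM.
rewrite ge0_esumZl//; last by move=> s; rewrite lee_fin prodr_ge0.
rewrite (@esum_signals (fun i => pS C (w.2 i ord0))) ?mule1// => i.
exact: pS_pmf.
Qed.

(** The dependence of [P] on t is a separate factor, a product of channel laws; it sums to 1 and is
    then multiplied back. *)
Lemma resampled_admissible : resampled C P = P.
Proof.
have [_ [pQ [pX [pQ_pmf pX_pmf PE]]]] := P_adm.
apply: functional_extensionality_dep => -[[q t] x]; rewrite /resampled /=.
have Pt (t' : signals S) : P (q, t', x) =
    pQ q * (\prod_(i : bool) \prod_(j : users i) pX i j q (x i j)) *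
    \prod_(i : bool) pS C (x i ord0) (t' i).
  by rewrite PE !big_split /=; ring.
under eq_esum do rewrite Pt EFinM.
rewrite ge0_esumZl; last 2 first.
- rewrite mulr_ge0 ?pQ_pmf.1// prodr_ge0// => i _; rewrite prodr_ge0// => j _.
  exact: (pX_pmf _ _ _).1.
- move=> s; rewrite lee_fin prodr_ge0// => i _; exact: (pS_pmf C _).1.
rewrite (@esum_signals (fun i => pS C (x i ord0))) ?mule1/= ?Pt// => i.
exact: pS_pmf.
Qed.

(** * Product structure of the law and exchanges that preserve it *)

Definition xs i (w : outcome) : forall j, X j := w.1.2 i.

(** All independences used below can be read off this form: given Q the two sides separate, and T_i
    and S_i enter symmetrically, each through X_i.1 only. *)
Lemma law_split : exists (f : Q -> R) (h : forall i, Q -> (forall j, X j) -> R),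
  forall w, law C P w = f (rvQ w) * \prod_(i : bool)
    (h i (rvQ w) (@xs i w) * pS C (@xs i w ord0) (rvT i w) *
     pS C (@xs i w ord0) (rvS i w)).
Proof.
have [_ [pQ [pX [_ _ PE]]]] := P_adm.
exists pQ, (fun i q x => \prod_(j : users i) pX i j q (x j)).
by move=> [[[q t] x] s]; rewrite /law PE /= !big_split /=; ring.
Qed.


Local Notation H a b := (cond_entropy (law C P) a b).
Local Notation rvXs A := (@rvXs _ X S Q _ A).

Lemma eq_rvXs i (A : {set users i}) (v w : outcome) :
  @xs i v = @xs i w -> rvXs A v = rvXs A w.
Proof.
by rewrite /xs => vw; apply: functional_extensionality_dep => j; rewrite /Defs.rvXs vw.
Qed.

Definition override i (F : bool -> Type) (f g : forall k, F k) : forall k, F k :=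
  fun k => if k == i then f k else g k.

Lemma override_eq i (F : bool -> Type) (f g : forall k, F k) : override i f g i = f i.
Proof. by rewrite /override eqxx. Qed.

Lemma override_neq i (F : bool -> Type) (f g : forall k, F k) :
  override i f g (~~ i) = g (~~ i).
Proof. by case: i. Qed.

(** Exchanging T_i between samples that agree on X_i.1 encodes that T_i is independent of all the
    rest given X_i.1. *)
Definition set_T i (v v' : outcome) : outcome :=
  (v.1.1.1, override i v'.1.1.2 v.1.1.2, v.1.2, v.2).

(** Exchanging a whole side between samples that agree on Q encodes that the two sides are
    independent given Q. *)
Definition set_side i (v v' : outcome) : outcome :=
  (v.1.1.1, override i v'.1.1.2 v.1.1.2, override i v'.1.2 v.1.2,
   override i v'.2 v.2).

Lemma set_TK i v v' : set_T i (set_T i v v') (set_T i v' v) = v.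
Proof.
move: v v' => [[[q t] x] s] [[[q' t'] x'] s']; rewrite /set_T /=.
congr (_, _, _, _); apply: functional_extensionality_dep => k.
by rewrite /override; case: (k == i).
Qed.

Lemma set_sideK i v v' :
  set_side i (set_side i v v') (set_side i v' v) = v.
Proof.
move: v v' => [[[q t] x] s] [[[q' t'] x'] s']; rewrite /set_side /=.
by congr (_, _, _, _); apply: functional_extensionality_dep => k;
  rewrite /override; case: (k == i).
Qed.

Lemma law_set_T i v v' : rvX1 i v = rvX1 i v' ->
  law C P (set_T i v v') * law C P (set_T i v' v) = law C P v * law C P v'.
Proof.
have [f [h lawE]] := law_split; rewrite !lawE !big_bool.
case: i; rewrite /rvX1 /rvQ /xs /rvT /rvS /= => ->; ring.
Qed.

Lemma law_set_side i v v' : rvQ v = rvQ v' ->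
  law C P (set_side i v v') * law C P (set_side i v' v) = law C P v * law C P v'.
Proof.
have [f [h lawE]] := law_split; rewrite !lawE !big_bool.
case: i; rewrite /rvQ /xs /rvT /rvS /= => ->; ring.
Qed.

(** * Markov chains and symmetries as identities of entropies *)

Let pmf := law_pmf.

Local Opaque cond_entropy.

Lemma cond_entropy_given_T i (A B : Type) (a : outcome -> A) (b : outcome -> B) :
  (forall v w, b v = b w -> rvX1 i v = rvX1 i w) ->
  (forall v w, a (set_T i v w) = a v) -> (forall v w, b (set_T i v w) = b v) ->
  H a (fun w => (b w, rvT i w)) = H a b.
Proof.
move=> bX aT bT; apply: (cond_entropy_markov pmf (mix := set_T i)).
  by move=> v w [].
move=> v w vw; split; [exact/law_set_T/bX|exact: aT| |exact: set_TK].
by rewrite bT vw /rvT /= override_eq.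
Qed.

(** The chain of [cond_entropy_given_T] read from its other end: T_i comes from the first sample and
    the rest from the second, hence the reversed arguments of [set_T]. *)
Lemma cond_entropy_T i (A : Type) (a : outcome -> A) :
  (forall v w, a v = a w -> rvX1 i v = rvX1 i w /\ rvQ v = rvQ w) ->
  (forall v w, a (set_T i v w) = a v) ->
  H (rvT i) a = H (rvT i) (fun w => (rvX1 i w, rvQ w)).
Proof.
move=> aXQ aT; apply: (cond_entropy_markov pmf (mix := fun v w => set_T i w v)).
  by move=> v w /aXQ[-> ->].
move=> v w [vwX vwQ]; split; last exact: set_TK.
- by rewrite mulrC law_set_T.
- by rewrite /rvT /= override_eq.
- exact: aT.
Qed.

(** The last hypothesis says that what [a] records beyond [b] comes from the other side, which
    carries no information on side [i] given Q. *)
Lemma cond_entropy_S_side i (A B : Type) (a : outcome -> A) (b : outcome -> B) :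
  (forall v w, a v = a w -> b v = b w) ->
  (forall v w, b v = b w -> rvQ v = rvQ w) ->
  (forall v w, b v = b w -> a (set_side i w v) = a w) ->
  H (rvS i) a = H (rvS i) b.
Proof.
move=> ab bQ aside.
apply: (cond_entropy_markov pmf (mix := fun v w => set_side i w v)) => //.
move=> v w vw; split; last exact: set_sideK.
- by rewrite mulrC law_set_side//; exact: bQ.
- by rewrite /rvS /= override_eq.
- exact: aside.
Qed.

(** Here semi-determinism enters: once its own inputs are known, Y_i and the interfering signal
    determine each other. *)
Lemma cond_entropy_YS i (A : Type) (a : outcome -> A) :
  (forall v w, a v = a w -> @xs i v = @xs i w) ->
  H (@rvY _ _ _ _ _ C Q i) a = H (rvS (~~ i)) a.
Proof.
move=> ax; apply: eq_cond_entropy => v w /ax; rewrite /xs /rvY /rvS => ->.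
by split=> [/(@phi_inj _ _ _ _ _ C)|->].
Qed.

Definition swap_TS (w : outcome) : outcome := (w.1.1.1, w.2, w.1.2, w.1.1.2).

Lemma law_swap_TS w : law C P (swap_TS w) = law C P w.
Proof.
have [f [h lawE]] := law_split; rewrite !lawE; congr (_ * _).
by apply: eq_bigr => i _; rewrite /swap_TS /xs /rvT /rvS /=; ring.
Qed.

Lemma swap_TSK : involutive swap_TS.
Proof. by case=> [[[q t] x] s]. Qed.

(** Given the inputs, T_i and S_i are independent draws from the same channel. *)
Lemma cond_entropy_TS i (A : Type) (a : outcome -> A) :
  (forall w, a (swap_TS w) = a w) -> H (rvT i) a = H (rvS i) a.
Proof.
move=> aTS; rewrite -(cond_entropy_reindex (rvS i) a swap_TSK law_swap_TS).
by congr cond_entropy; apply: functional_extensionality_dep => w /=; rewrite aTS.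
Qed.

(** * Comparison of output and signal entropies *)

Local Notation Y_ i := (@rvY _ _ _ _ _ C Q i).
Local Notation Q_ := (@rvQ _ X S Q).
Local Notation H_ST i := (H (rvS i) (fun w => (rvT i w, rvQ w))).
Local Notation H_SX i := (H (rvS i) (fun w => (rvX1 i w, rvQ w))).

(** S_i and T_i are independent given X_i.1, so I(X_i.1; S_i | T_i, Q) becomes [H_ST i] minus
    [H_SX i]. *)
Lemma H_STX i : H (rvS i) (fun w => (rvX1 i w, (rvT i w, rvQ w))) = H_SX i.
Proof.
rewrite -(@cond_entropy_given_T i _ _ (rvS i) (fun w => (rvX1 i w, rvQ w)))//;
  last by move=> v w [].
apply: (eq_cond_entropy_cond pmf) => v w.
by split=> -[-> -> ->].
Qed.

Lemma H_SX_le_ST i : (H_SX i <= H_ST i)%E.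
Proof. by rewrite -H_STX cond_entropy_le// => v w [_ -> ->]. Qed.

(** Conditioning further on all inputs of receiver i and on both T's turns Y_i into S_i', which then
    depends on the condition only through T_i' and Q. This makes the inner set functions
    nonnegative. *)
Lemma H_S_le_Y i (A : Type) (a : outcome -> A) :
  (forall v w, @xs i v = @xs i w -> rvT i v = rvT i w ->
     rvT (~~ i) v = rvT (~~ i) w -> rvQ v = rvQ w -> a v = a w) ->
  (H_ST (~~ i) <= H (Y_ i) a)%E.
Proof.
move=> xTTQa.
pose b w := (@xs i w, rvT i w, rvT (~~ i) w, Q_ w).
apply: (@le_trans _ _ (H (Y_ i) b)).
  2: by apply: (cond_entropy_le pmf) => v w [*]; exact: xTTQa.
rewrite cond_entropy_YS; last by move=> v w [].
rewrite le_eqVlt; apply/predU1l/esym/cond_entropy_S_side.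
- by move=> v w [_ _ -> ->].
- by move=> v w [].
- move=> v w [+ _]; rewrite /b /set_side /override /xs /rvT /rvQ /=.
  by case: (i) => /= ->.
Qed.

Lemma H_S_other i (A : Type) (a : outcome -> A) :
  (forall v w, a v = a w -> rvQ v = rvQ w) ->
  (forall v w, rvQ v = rvQ w -> a (set_side i w v) = a w) ->
  H (rvS i) a = H (rvS i) Q_.
Proof. by move=> aQ aside; apply: cond_entropy_S_side. Qed.

Lemma H_S_le_Y_other i (A : Type) (a : outcome -> A) :
  (forall v w, @xs (~~ i) v = @xs (~~ i) w -> rvT (~~ i) v = rvT (~~ i) w ->
    rvQ v = rvQ w -> a v = a w) ->
  (H (rvS i) Q_ <= H (Y_ (~~ i)) a)%E.
Proof.
move=> xTQa.
pose b w := (@xs (~~ i) w, rvT (~~ i) w, Q_ w).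
apply: (@le_trans _ _ (H (Y_ (~~ i)) b)).
  2: by apply: (cond_entropy_le pmf) => v w [*]; exact: xTQa.
rewrite cond_entropy_YS; last by move=> v w [].
rewrite (_ : H _ b = H (rvS i) b); last by case: (i) @b xTQa.
rewrite H_S_other => [//|v w []//|v w vw].
by rewrite /b /set_side /override /xs /rvT /rvQ /=; case: (i).
Qed.

(** This is I(Y_i; T_i | a) <= H(S_i | Q) - H(S_i | X_i.1, Q), in additive form so that no entropy
    has to be finite. *)
Lemma H_Y_le i (A : Type) (a : outcome -> A) :
  (forall v w, a v = a w -> rvQ v = rvQ w) ->
  (forall v w, @xs i v = @xs i w -> rvT (~~ i) v = rvT (~~ i) w ->
     rvQ v = rvQ w -> a v = a w) ->
  (H (Y_ i) a + H_SX i <=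
   H (rvS i) Q_ + H (Y_ i) (fun w => (rvT i w, a w)))%E.
Proof.
(* [b] is the whole outcome except T_i. It determines Y_i and [a], yet tells no more about T_i than
   X_i.1 and Q do; hence H(T_i | X_i.1, Q) <= H(T_i | Y_i, a). *)
move=> aQ xTQa; pose b (w : outcome) := (rvQ w, w.1.2, w.2, rvT (~~ i) w).
rewrite -(@cond_entropy_TS i _ Q_)// -(@cond_entropy_TS i _ (fun w => (rvX1 i w, rvQ w)))//.
rewrite -(@cond_entropy_T i _ b); last 2 first.
- by move=> v w [vwQ vwx _ _]; rewrite /rvX1 vwx.
- by move=> v w; rewrite /b /rvT /= override_neq.
apply: (@le_trans _ _ (H (rvT i) a + H (Y_ i) (fun w => (rvT i w, a w)))%E).
  rewrite -(cond_entropy_symmetry pmf (Y_ i)) leeD2l//.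
  apply: (cond_entropy_le pmf) => v w [vwQ vwx vws vwT].
  by congr pair; [rewrite /rvY vwx vws|apply: xTQa; rewrite // /xs vwx].
by rewrite leeD2r// cond_entropy_le.
Qed.

Lemma rvT_set_T i v w : rvT i (set_T (~~ i) v w) = rvT i v.
Proof. by rewrite /rvT /= /override; case: (i). Qed.

Local Opaque law rvY rvS rvT rvX1 rvQ Defs.rvXs.

(** * Finiteness of the entropies *)

Hypothesis outer_fin : real_valued (outer_A C P) (outer_B C P) (outer_E C P) (outer_G C P).

(** A difference is finite only if both terms are. At the set of all users, [outer_G] conditions Y_i
    on Q alone, and the finiteness of all entropies below derives from this case. *)
Lemma fin_H_YS i : H (Y_ i) (fun w => (rvXs (~: [set: users i]%SET) w, rvQ w))
    \is a fin_num /\ H_SX (~~ i) \is a fin_num.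
Proof.
have [_ /(_ [set: users i]%SET)[|_]] := outer_fin i.
  by apply/set0Pn; exists ord0.
by rewrite fin_numB => /andP.
Qed.

Lemma fin_H_SX i : H_SX i \is a fin_num.
Proof. by rewrite -(negbK i); have [] := fin_H_YS (~~ i). Qed.

Lemma fin_H_Y i (A : Type) (a : outcome -> A) :
  (forall v w, a v = a w -> rvQ v = rvQ w) -> H (Y_ i) a \is a fin_num.
Proof.
move=> aQ; rewrite ge0_fin_numE ?cond_entropy_ge0//.
apply: (le_lt_trans _ (_ : H (Y_ i) (fun w => (rvXs (~: [set: users i]%SET) w, rvQ w)) < +oo)%E).
  2: by rewrite -ge0_fin_numE ?cond_entropy_ge0//; have [] := fin_H_YS i.
apply: (cond_entropy_le pmf) => v w vw; congr pair; last exact: aQ.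
apply: functional_extensionality_dep => -[j jT].
by exfalso; move: jT; rewrite !finset.inE.
Qed.

Lemma fin_H_SQ i : H (rvS i) Q_ \is a fin_num.
Proof.
rewrite ge0_fin_numE ?cond_entropy_ge0//.
apply: (le_lt_trans (@H_S_le_Y_other i _ Q_ (fun _ _ _ _ => id))).
by rewrite -ge0_fin_numE ?cond_entropy_ge0// fin_H_Y.
Qed.

Lemma fin_H_ST i : H_ST i \is a fin_num.
Proof.
rewrite ge0_fin_numE ?cond_entropy_ge0//.
apply: (@le_lt_trans _ _ (H (rvS i) Q_)).
  by apply: (cond_entropy_le pmf) => v w [].
by rewrite -ge0_fin_numE ?cond_entropy_ge0// fin_H_SQ.
Qed.

(** * Comparison of outer and inner set functions *)

Local Notation I_ i :=
  (cond_mutual_info (law C P) (rvX1 i) (rvS i) (fun w => (rvT i w, rvQ w))).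

Definition info i : R := fine (I_ i).

Lemma EFin_info i : (info i)%:E = I_ i.
Proof. by rewrite fineK// fin_numB H_STX fin_H_ST fin_H_SX. Qed.

Lemma H_STE i : H_ST i = (H_SX i + (info i)%:E)%E.
Proof.
by rewrite EFin_info /cond_mutual_info H_STX addeC subeK// fin_H_SX.
Qed.

Lemma info_ge0 i : 0 <= info i.
Proof.
rewrite -lee_fin EFin_info /cond_mutual_info H_STX sube_ge0 ?H_SX_le_ST//.
by rewrite fin_H_SX.
Qed.

Lemma gapE : gap C P = info true + info false.
Proof.
by rewrite /gap resampled_admissible /sum_cond_info big_bool -!EFin_info.
Qed.

(** The subtracted signal entropies differ by exactly [info (~~ i)], so only the entropies of Y_i
    are left to compare. *)
Lemma outer_le_inner i (A B : Type) (a : outcome -> A) (b : outcome -> B) :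
  (H (Y_ i) a <= H (Y_ i) b)%E ->
  (H (Y_ i) a - H_SX (~~ i) <= H (Y_ i) b - H_ST (~~ i) + (info (~~ i))%:E)%E.
Proof.
move=> ab; rewrite H_STE -(fineK (fin_H_SX (~~ i))) -EFinD -!EFinN -addeA -EFinD.
by rewrite opprD addrNK leeD2r.
Qed.

(** T_i' can be added to the condition for free while X_i'.1 is there; dropping X_i'.1 afterwards
    only raises the entropy. *)
Lemma H_Y_X1_le_T i (A B : Type) (a : outcome -> A) (b : outcome -> B) :
  (forall v w, a v = a w -> rvX1 (~~ i) v = rvX1 (~~ i) w) ->
  (forall v w, a (set_T (~~ i) v w) = a v) ->
  (forall v w, a v = a w -> rvT (~~ i) v = rvT (~~ i) w -> b v = b w) ->
  (H (Y_ i) a <= H (Y_ i) b)%E.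
Proof.
move=> aX aT aTb; rewrite -(@cond_entropy_given_T (~~ i) _ _ (Y_ i) a)//.
by apply: (cond_entropy_le pmf) => v w [+ +]; exact: aTb.
Qed.

Local Notation Xs A := (rvXs A).

Lemma inner_fin : real_valued (inner_A C P) (inner_B C P) (inner_E C P) (inner_G C P).
Proof.
have fin_sub i (A : Type) (a : outcome -> A) :
    (forall v w, a v = a w -> rvQ v = rvQ w) ->
    (H (Y_ i) a - H_ST (~~ i))%E \is a fin_num.
  by move=> aQ; rewrite fin_numB; apply/andP; split; [exact: fin_H_Y|exact: fin_H_ST].
by move=> i; split=> D _; split; apply: fin_sub => v w [].
Qed.

Lemma outer_A_le i (U : {set users i}) :
  (outer_A C P U <= inner_A C P U + (info (~~ i))%:E)%E.
Proof.
apply/outer_le_inner/H_Y_X1_le_T => [v w []//|v w|v w [-> -> _ ->] -> //].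
by rewrite rvT_set_T.
Qed.

Lemma outer_B_le i (O : {set users i}) :
  (outer_B C P O <= inner_B C P O + (info (~~ i))%:E)%E.
Proof.
by apply/outer_le_inner/H_Y_X1_le_T => [v w []//|v w|v w [-> _ ->] -> //].
Qed.

Lemma outer_E_le i (U : {set users i}) :
  (outer_E C P U <= inner_E C P U + (info (~~ i))%:E)%E.
Proof. exact: outer_le_inner. Qed.

Lemma outer_G_le i (O : {set users i}) :
  (outer_G C P O <= inner_G C P O + (info (~~ i))%:E)%E.
Proof. exact: outer_le_inner. Qed.

Lemma H_Y_sub_ge0 i (A : Type) (a : outcome -> A) :
  (forall v w, @xs i v = @xs i w -> rvT i v = rvT i w ->
     rvT (~~ i) v = rvT (~~ i) w -> rvQ v = rvQ w -> a v = a w) ->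
  (0 <= H (Y_ i) a - H_ST (~~ i))%E.
Proof.
move=> /H_S_le_Y; rewrite -sube_ge0; first by [].
by apply/orP; left; exact: fin_H_ST.
Qed.

Lemma inner_A_E i (U : {set users i}) : (0 <= inner_A C P U <= inner_E C P U)%E.
Proof.
apply/andP; split.
  by apply: H_Y_sub_ge0 => v w vwx -> -> ->; rewrite (eq_rvXs _ vwx).
by apply: leeD2r; apply: (cond_entropy_le pmf) => v w [-> -> _ ->].
Qed.

Lemma inner_B_G i (O : {set users i}) : (0 <= inner_B C P O <= inner_G C P O)%E.
Proof.
apply/andP; split.
  by apply: H_Y_sub_ge0 => v w vwx _ -> ->; rewrite (eq_rvXs _ vwx).
by apply: leeD2r; apply: (cond_entropy_le pmf) => v w [-> _ ->].
Qed.

Lemma inner_B_le i (U : {set users i}) (U' : {set users (~~ i)}) :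
  (inner_B C P U <= inner_A C P U + inner_E C P U' + (info i)%:E)%E.
Proof.
rewrite /inner_A (_ : H (Y_ i) _ = H (Y_ i)
    (fun w => (rvT i w, (Xs (~: U) w, rvT (~~ i) w, rvQ w)))); last first.
  by apply: (eq_cond_entropy_cond pmf) => v w; split=> -[-> -> -> ->].
have h1 : (H (Y_ i) (fun w => (Xs (~: U) w, rvT (~~ i) w, rvQ w)) + H_SX i <=
    H (rvS i) Q_ + H (Y_ i)
      (fun w => (rvT i w, (Xs (~: U) w, rvT (~~ i) w, rvQ w))))%E.
  by apply: H_Y_le => [v w []//|v w vwx -> ->]; rewrite (eq_rvXs _ vwx).
have h2 : (H (rvS i) Q_ <=
    H (Y_ (~~ i)) (fun w => (Xs (~: U') w, rvT (~~ i) w, rvQ w)))%E.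
  by apply: H_S_le_Y_other => v w vwx -> ->; rewrite (eq_rvXs _ vwx).
move: h1 h2; rewrite /inner_B /inner_E (_ : H_ST (~~ ~~ i) = H_ST i); last first.
  by case: (i).
rewrite (H_STE i) -(fineK (fin_H_SX i)) -(fineK (fin_H_ST (~~ i))) -(fineK (fin_H_SQ i)).
have := @fin_H_Y i _ (fun w => (Xs (~: U) w, rvT (~~ i) w, rvQ w)).
move=> /(_ (fun v w e => congr1 snd e))/fineK <-.
have := @fin_H_Y i _ (fun w => (rvT i w, (Xs (~: U) w, rvT (~~ i) w, rvQ w))).
move=> /(_ (fun v w e => congr1 (fun u => u.2.2) e))/fineK <-.
have := @fin_H_Y (~~ i) _ (fun w => (Xs (~: U') w, rvT (~~ i) w, rvQ w)).
move=> /(_ (fun v w e => congr1 snd e))/fineK <-.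
(* Adding [h1] and [h2] cancels H(S_i | Q). The term [info i] offsets the one contained in the
   signal entropy that [inner_E] subtracts. *)
rewrite -!EFinN -!EFinD !lee_fin.
by do 6 move: (fine _); move: (info i) => *; lra.
Qed.

Theorem inner_region_of_outer (r : rates R K) : outer_region_at C P r ->
  inner_region_at C P (fun i j => Num.max 0 (r i j - gap C P)).
Proof.
rewrite gapE => r_outer; apply: (region_shift r_outer) => [|i|i U U0|i U U0|i O O0
  |i O O0|i U U0|i O O0|i U U' U0 U0'].
- exact: inner_fin.
- exact: info_ge0.
- exact: outer_A_le.
- exact: outer_E_le.
- exact: outer_B_le.
- exact: outer_G_le.
- exact: inner_A_E.
- exact: inner_B_G.
- exact: inner_B_le.
Qed.

End law.

Theorem theorem5 (R : realType) (K : bool -> nat)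
    (X : forall i : bool, 'I_(K i).+1 -> countType)
    (S Y : bool -> countType) (C : sd_channel R X S Y)
    (Q : countType) (P : source X S Q -> R)
    (hP : admissible C P)
    (r : rates R K) (hr : outer_region_at C P r) :
  inner_region C (fun i j => Num.max 0 (r i j - gap C P)).
Proof.
by exists Q, P; split=> //; apply: inner_region_of_outer => //; have [] := hr.
Qed.
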